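(* Let $\Lambda=\mathbb R$ or $\Lambda=\mathbb R_+$, let $(\lambda_n)_{n\ge1}\subset\Lambda$ be a betting strategy and $(g_t)_{t\ge1}$ a prediction strategy valued in $\mathcal G$, with associated processes $L_n^{\rm H}(\lambda)$, $W_n^{\rm H}$ and stochastic regret $\mathcal S_n$ as defined in the context. Assume that there is a nonnegative sequence $(s_n)_{n\ge1}$ with $\varsigma:=\sum_{n\ge1}\mathbb P[\mathcal S_n>s_n]<+\infty$, and that the regret $\mathcal R_n:=\max_{\lambda\in\Lambda}\log L_n^{\rm H}(\lambda)-\log W_n^{\rm H}$ satisfies $\rho:=\sum_{n\ge1}\mathbb P[\mathcal R_n>r_n]<+\infty$ for some nonnegative sequence $(r_n)_{n\ge1}$. Let $(m_n)_{n\ge1}$ be a nonnegative sequence and suppose that $$\varrho_1:=\sum_{n\ge1}\mathbb P\Big(\sup_{g\in\mathcal G}\frac1n\sum_{t=1}^n\mathbb E_{t-1}[g(X_t)]<m_n\Big)<+\infty .$$ Set $$u_n:=\frac1{2n}\big(nm_n-s_n-2\sqrt{n\log(n)}\big)_+^2-r_n .$$ Then $$\sum_{n\ge1}\mathbb P[\log W_n^{\rm H}<u_n]\le\rho+\varsigma+\varrho_1+\frac{\pi^2}{6}<+\infty.$$ Hence $\liminf_{n\to+\infty}\frac{\log W_n^{\rm H}}{u_n}\ge1$ $\mathbb P$-a.s., and for any $\alpha\in(0,1)$, $$\mathbb E[\tau_\alpha^{\rm H}]\le\rho+\varrho_1+\varsigma+\frac{\pi^2}{6}+\aleph\big((u_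n)_{n\ge1},\log(1/\alpha)\big).$$
   Context: Let $(\Omega,\mathcal F,\mathbb P)$ be a probability space with filtration $(\mathcal F_t)_{t\in\mathbb N}$, and write $\mathbb E_{t-1}[\cdot]=\mathbb E[\cdot\mid\mathcal F_{t-1}]$. $(X_t)_{t\in\mathbb N}$ is an adapted process valued in a set $\mathsf X$ and $\mathcal G$ is a set of functions $\mathsf X\to[-1,1]$. A prediction strategy is a predictable sequence $(g_t)_{t\ge1}$ valued in $\mathcal G$, with stochastic regret $$\mathcal S_n:=\sup_{g\in\mathcal G}\sum_{t=1}^n\mathbb E_{t-1}[g(X_t)]-\sum_{t=1}^n\mathbb E_{t-1}[g_t(X_t)].$$ A betting strategy is a predictable sequence ($\lambda_n$ is $\mathcal F_{n-1}$-measurable). For $\lambda\in\Lambda$, $$L_n^{\rm H}(\lambda)=\prod_{t=1}^n\exp\big(\lambda g_t(X_t)-\lambda^2/2\big),\qquad W_n^{\rm H}=\prod_{t=1}^n\exp\big(\lambda_tg_t(X_t)-\lambda_t^2/2\big).$$ The sequences $(r_n)$, $(s_n)$, $(m_n)$ are deterministic. Also $\tau_\alpha^{\rm H}:=\inf\{n\in\mathbb N:W_n^{\rm H}\ge1/\alpha\}$, $z_+=\max(z,0)$ and $\aleph((u_n)_{n\ge1},x):=\inf\{n\ge1:\inf_{k\ge n}u_k\ge x\}$ (with $\inf\emptyset=+\infty$).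
   Formalization: The claim liminf log W_n^H / u_n ≥ 1 a.s. is proved only when u_n > 0 for all large n; without this it is false (e.g. fair signs, λ_n = 0, m_n = s_n = 0, r_n = n gives u_n = -n and ratio 0). *)

(* Defs.v *)
From HB Require Import structures.
From mathcomp Require Import all_boot all_order all_algebra.
From mathcomp Require Import all_classical all_reals all_analysis.

Set Implicit Arguments.
Unset Strict Implicit.
Unset Printing Implicit Defensive.

Import Order.TTheory GRing.Theory Num.Theory.
Import numFieldNormedType.Exports.

Local Open Scope classical_set_scope.
Local Open Scope ring_scope.

Section filtered_space.
Context {d : measure_display} {Omega : measurableType d}.

Definition is_filtration (F : nat -> set (set Omega)) : Prop :=
  [/\ forall n, sigma_algebra setT (F n),
      forall n, F n `<=` measurable &
      {homo F : m n / (m <= n)%N >-> m `<=` n}].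

(* Measurability with respect to a sub-sigma-algebra H of Omega is
   measurability out of [g_sigma_algebraType H], whose carrier is Omega and
   whose measurable sets are <<s H >> (= H, since H is a sigma-algebra). *)
Definition sub_measurable (H : set (set Omega)) {d' : measure_display}
    {Y : measurableType d'} (f : Omega -> Y) : Prop :=
  measurable_fun [set: g_sigma_algebraType H]
    (f : g_sigma_algebraType H -> Y).

Definition adapted (F : nat -> set (set Omega)) {d' : measure_display}
    {Y : measurableType d'} (X : nat -> Omega -> Y) : Prop :=
  forall t, sub_measurable (F t) (X t).

(* Predictable sequences are indexed by t >= 1; their value at t = 0 is
   irrelevant. *)
Definition predictable (F : nat -> set (set Omega)) {d' : measure_display}
    {Y : measurableType d'} (f : nat -> Omega -> Y) : Prop :=
  forall t, (1 <= t)%N -> sub_measurable (F t.-1) (f t).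

Context {R : realType} (P : probability Omega R).

Definition is_condexp (H : set (set Omega)) (Y Z : Omega -> R) : Prop :=
  [/\ sub_measurable H Z,
      P.-integrable setT (EFin \o Z) &
      forall A, H A ->
        (\int[P]_(w in A) (Z w)%:E = \int[P]_(w in A) (Y w)%:E)%E].

(* E t Y is a version of the conditional expectation of Y given F t.  The
   choice of the versions is left arbitrary. *)
Definition is_condexp_family (F : nat -> set (set Omega))
    (E : nat -> (Omega -> R) -> Omega -> R) : Prop :=
  forall t (Y : Omega -> R), P.-integrable setT (EFin \o Y) ->
    is_condexp (F t) Y (E t Y).

End filtered_space.

Section betting.
Context {R : realType} {d d' : measure_display}.
Context {Omega : measurableType d} {XX : measurableType d'}.

(* A predictable sequence of random functions: g t w is in G, and
   (w, x) |-> g t w x is measurable for the product of F t.-1 and the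
   sigma-algebra of XX. *)
Definition prediction_strategy (F : nat -> set (set Omega))
    (G : set (XX -> R)) (g : nat -> Omega -> XX -> R) : Prop :=
  forall t, (1 <= t)%N ->
    (forall w, G (g t w)) /\
    measurable_fun [set: g_sigma_algebraType (F t.-1) * XX]
      (fun p : g_sigma_algebraType (F t.-1) * XX => g t p.1 p.2).

Definition betting_strategy (F : nat -> set (set Omega))
    (Lambda : set R) (lambda : nat -> Omega -> R) : Prop :=
  predictable F lambda /\
  forall t, (1 <= t)%N -> forall w, Lambda (lambda t w).

Variables (E : nat -> (Omega -> R) -> Omega -> R) (X : nat -> Omega -> XX).
Variables (g : nat -> Omega -> XX -> R).

Definition condexp_sum (f : XX -> R) (n : nat) (w : Omega) : R :=
  \sum_(1 <= t < n.+1) E t.-1 (fun w' => f (X t w')) w.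

(* The supremum is taken in \bar R: arbitrary versions of the conditional
   expectations need not be bounded uniformly over an uncountable G. *)
Definition stochastic_regret (G : set (XX -> R)) (n : nat) (w : Omega) :
    \bar R :=
  (ereal_sup [set (condexp_sum f n w)%:E | f in G]
   - (\sum_(1 <= t < n.+1) E t.-1 (fun w' => g t w' (X t w')) w)%:E)%E.

Definition LH (lam : R) (n : nat) (w : Omega) : R :=
  \prod_(1 <= t < n.+1) expR (lam * g t w (X t w) - lam ^+ 2 / 2).

Definition WH (lambda : nat -> Omega -> R) (n : nat) (w : Omega) : R :=
  \prod_(1 <= t < n.+1)
    expR (lambda t w * g t w (X t w) - lambda t w ^+ 2 / 2).

(* For n >= 1 the supremum over Lambda = R or [0, +oo[ is attained: ln (LH ..)
   is a concave parabola in lam. *)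
Definition regret (Lambda : set R) (lambda : nat -> Omega -> R)
    (n : nat) (w : Omega) : \bar R :=
  (ereal_sup [set (ln (LH lam n w))%:E | lam in Lambda]
   - (ln (WH lambda n w))%:E)%E.

Definition tauH (lambda : nat -> Omega -> R) (alpha : R) (w : Omega) :
    \bar R :=
  ereal_inf [set (n%:R)%:E | n in [set n : nat | 1 / alpha <= WH lambda n w]].

End betting.

Definition aleph {R : realType} (u : nat -> R) (x : R) : \bar R :=
  ereal_inf [set (n%:R)%:E | n in [set n : nat | (1 <= n)%N /\
    (x%:E <= ereal_inf [set (u k)%:E | k in [set k : nat | (n <= k)%N]])%E]].

(* Main.v *)
Require Import Defs.
From HB Require Import structures.
From mathcomp Require Import all_boot all_order all_algebra ring lra zify.
From mathcomp Require Import all_classical all_reals all_analysis.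
From mathcomp Require Import measurable_realfun.
Import Order.TTheory GRing.Theory Num.Theory.
Import numFieldNormedType.Exports.
Local Open Scope classical_set_scope.
Local Open Scope ring_scope.

(** Let S_n be the realized gain, the sum of g_t(X_t) for t <= n, and C_n its
    compensator, the sum of E_(t-1)[g_t(X_t)].  The log-likelihood
    log L_n(lam) = lam S_n - n lam^2 / 2 is a parabola in lam, with maximum at
    least (S_n)_+^2 / (2n) over Lambda ([sup_log_likelihood]).  So log W_n can
    only fall below u_n if one of four things happens: the betting regret
    exceeds r_n; the stochastic regret exceeds s_n; the best achievable average
    conditional gain is below m_n; or S_n - C_n < - 2 sqrt (n log n).  Outside
    the first three events C_n >= n m_n - s_n, and if the fourth one fails too
    then S_n >= n m_n - s_n - 2 sqrt (n log n), whence log W_n >= u_n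
    ([log_wealth_ge]).

    The first three events account for rho, varsigma and varrho1.  The fourth
    is a deviation of a martingale whose increments g_t(X_t) - E_(t-1)[g_t(X_t)]
    are conditionally centred and live in an interval of length 2, so the
    Azuma-Hoeffding inequality ([azuma_hoeffding]) bounds its probability by
    exp (- 4 n log n / (2n)) = 1 / n^2, and these bounds add up to at most
    pi^2 / 6 ([nneseries_inv2_le]).

    Hoeffding's conditional bound is obtained without conditional expectations
    of exponentials.  By convexity exp (- th Y) lies below a chord, affine in
    Y ([expR_le_chord]); integrated against a weight known at time t - 1, an
    affine function of Y may be replaced by the same function of its conditional
    mean Z ([le_integral_mul]); and the chord at Z is at most
    exp (th^2 / 2 - th Z) ([exp_chord_le]).

    The almost sure statement is then the Borel-Cantelli lemma.  For the
    expectation, if u_k >= log (1 / alpha) for all k >= N, the betting process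
    is still below 1 / alpha at time k >= N only on the event log W_k < u_k, so
    tau is at most N plus the number of such events that occur
    ([integral_first_exit_le]). *)

Set Implicit Arguments.
Unset Strict Implicit.
Unset Printing Implicit Defensive.

(** * The sum of the inverse squares *)

Lemma ger0_is_derive_ge (R : realType) (f f' : R -> R) :
  (forall x, is_derive x (1 : R) f (f' x)) -> (forall x, 0 <= x -> 0 <= f' x) ->
  forall x, 0 <= x -> f 0 <= f x.
Proof.
move=> df f'0 x x0.
apply: (@ger0_derive1_ndecry _ f 0) => //.
- move=> y; rewrite in_itv/= andbT => y0.
  by rewrite derive1E (@derive_val _ _ _ _ _ _ _ (df y)) f'0// ltW.
- apply: continuous_subspaceT => y; apply: differentiable_continuous.
  by apply/derivable1_diffP; have := df y; case.
Qed.

Lemma sin_lex (R : realType) (x : R) : 0 <= x -> sin x <= x.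
Proof.
move=> x0; rewrite -subr_ge0.
have := @ger0_is_derive_ge R (fun x => x - sin x) (fun x => 1 - cos x).
rewrite sin0 subr0; exact.
Qed.

(** Half-angle identity: 1/sin^2 + 1/cos^2 = 1/(sin cos)^2. *)
Lemma csc2_half (R : realType) (a : R) : 0 < a < pi / 2 ->
  (sin a) ^- 2 + (sin (pi / 2 - a)) ^- 2 = 4 * (sin (a * 2)) ^- 2.
Proof.
move=> /andP[a0 a1].
have s0 : 0 < sin a by apply: sin_gt0_pihalf; rewrite a0.
have c0 : 0 < cos a by apply: cos_gt0_pihalf; rewrite a1 andbT; lra.
rewrite sinB cos_pihalf sin_pihalf mul0r subr0 mul1r.
rewrite mulr_natr sin_mulr2n.
have -> : 4 * ((cos a * sin a) *+ 2) ^- 2 =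
    (sin a ^+ 2 + cos a ^+ 2) * (cos a * sin a) ^- 2.
  by rewrite addrC cos2Dsin2; field; rewrite !gt_eqF.
by field; rewrite !gt_eqF.
Qed.

(** The angles are the odd multiples of pi / 2^(n+2) in the first quadrant.
    Halving an angle and its complement to pi gives two angles of the next
    level, so [csc2_half] multiplies the sum by 4 at each step; starting from
    the single angle pi / 4, the sum has a closed form. *)
Lemma sum_csc2 (R : realType) n :
  \sum_(k < 2 ^ n) (sin ((2 * k + 1)%:R * pi / (2 ^ n.+2)%:R : R)) ^- 2 =
  (2 * 4 ^ n)%:R.
Proof.
have pi0 := pi_gt0 R.
elim: n => [|n IHn].
  rewrite big_ord1 muln0 mul1r muln1.
  have := @csc2_half R (pi / 4).
  have -> : pi / 2 - pi / 4 = pi / 4 :> R by lra.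
  have -> : pi / 4 * 2 = pi / 2 :> R by lra.
  rewrite sin_pihalf expr1n invr1 mulr1 => h.
  rewrite [(2 ^ 2)%:R](_ : _ = 4)//.
  have : 0 < (pi : R) / 4 < pi / 2 by lra.
  by move=> /h; lra.
pose G (k : nat) : R := (sin ((2 * k + 1)%:R * pi / (2 ^ n.+3)%:R)) ^- 2.
rewrite -[LHS]/(\sum_(k < 2 ^ n.+1) G k) expnS mul2n -addnn big_split_ord/=.
(* the second half is indexed backwards, to pair each angle a with pi / 2 - a *)
rewrite [X in _ + X](reindex_inj rev_ord_inj)/=.
rewrite -big_split/=.
transitivity (\sum_(k < 2 ^ n) 4 *
   (sin ((2 * k + 1)%:R * pi / (2 ^ n.+2)%:R : R)) ^- 2); last first.
  by rewrite -mulr_sumr IHn -natrM expnS; congr (_%:R); ring.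
apply: eq_bigr => k _; rewrite /G.
have k2 := ltn_ord k.
have D0 : (2 ^ n)%:R != 0 :> R by rewrite pnatr_eq0 expn_eq0.
have D1 : 0 < (2 ^ n.+3)%:R :> R by rewrite ltr0n expn_gt0.
set a := (2 * k + 1)%:R * pi / (2 ^ n.+3)%:R.
have -> : (2 * (2 ^ n + (2 ^ n - k.+1)) + 1)%:R * pi / (2 ^ n.+3)%:R =
    pi / 2 - a :> R.
  rewrite /a (_ : 2 * (2 ^ n + (2 ^ n - k.+1)) + 1 = 4 * 2 ^ n - (2 * k + 1))%N; last by lia.
  rewrite natrB; last by lia.
  rewrite [(2 ^ n.+3)%N](_ : _ = 8 * 2 ^ n)%N; last by rewrite !expnS; ring.
  rewrite !natrM; field; lra.
have -> : (2 * k + 1)%:R * pi / (2 ^ n.+2)%:R = a * 2 :> R.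
  rewrite /a [(2 ^ n.+3)%N](_ : _ = 2 * 2 ^ n.+2)%N; last by rewrite !expnS; ring.
  rewrite natrM; field; rewrite pnatr_eq0 expn_eq0/=; lra.
apply: csc2_half; rewrite /a; apply/andP; split.
  by rewrite divr_gt0// mulr_gt0// ltr0n addn1.
rewrite ltr_pdivrMr// expnS natrM (_ : pi / 2 * _ = (2 ^ n.+2)%:R * pi); last first.
  by field; lra.
by rewrite ltr_pM2r// ltr_nat !expnS; lia.
Qed.

(** [sum_csc2] with 1/sin^2 bounded below by 1/x^2: the constant does not
    depend on the number of terms, since the angles scale like 2^-n and the sum
    like 4^n. *)
Lemma sum_odd_inv2 (R : realType) n :
  \sum_(k < n) ((2 * k + 1)%:R : R) ^- 2 <= pi ^+ 2 / 8.
Proof.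
have pi0 := pi_gt0 R.
have n2 : (n <= 2 ^ n)%N by rewrite ltnW// ltn_expl.
apply: (@le_trans _ _ (\sum_(k < 2 ^ n) ((2 * k + 1)%:R : R) ^- 2)).
  rewrite (big_ord_widen _ (fun k => ((2 * k + 1)%:R : R) ^- 2) n2).
  by rewrite big_mkcond/=; apply: ler_sum => k _; case: ifP.
have D0 : 0 < (2 ^ n)%:R :> R by rewrite ltr0n expn_gt0.
have := sum_csc2 R n.
have -> : (2 * 4 ^ n)%:R = 2 * (2 ^ n)%:R ^+ 2 :> R.
  by rewrite natrM -natrX -expnM mulnC expnM.
move=> h.
have : \sum_(k < 2 ^ n) (((2 * k + 1)%:R * pi / (2 ^ n.+2)%:R : R)) ^- 2 <=
   2 * (2 ^ n)%:R ^+ 2.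
  rewrite -h; apply: ler_sum => k _.
  set a := (X in X ^- 2).
  have a0 : 0 < a by rewrite /a divr_gt0 ?mulr_gt0 ?ltr0n ?addn1// expn_gt0.
  have k2 := ltn_ord k.
  have api : a < pi.
    rewrite /a ltr_pdivrMr ?ltr0n ?expn_gt0// mulrC ltr_pM2l// ltr_nat.
    by rewrite !expnS; lia.
  have s0 : 0 < sin a by apply: sin_gt0_pi; rewrite a0.
  rewrite lef_pV2 ?posrE ?exprn_gt0//.
  by rewrite lerXn2r ?nnegrE ?(ltW s0) ?(ltW a0)// sin_lex// ltW.
have -> : \sum_(k < 2 ^ n) (((2 * k + 1)%:R * pi / (2 ^ n.+2)%:R : R)) ^- 2 =
    (\sum_(k < 2 ^ n) (2 * k + 1)%:R ^- 2) * (16 * (2 ^ n)%:R ^+ 2 / pi ^+ 2).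
  rewrite mulr_suml; apply: eq_bigr => k _.
  rewrite [(2 ^ n.+2)%N](_ : _ = 4 * 2 ^ n)%N; last by rewrite !expnS; ring.
  rewrite natrM; move: (pi : R) pi0 => p p0; field.
  by rewrite (gt_eqF p0) (gt_eqF D0) -natrM natr1 pnatr_eq0.
rewrite -ler_pdivlMr; last by rewrite divr_gt0 ?mulr_gt0 ?exprn_gt0.
move=> /le_trans; apply.
move: (pi : R) pi0 => p p0; rewrite le_eqVlt; apply/orP; left; apply/eqP; field.
by rewrite !gt_eqF.
Qed.

(** Euler's bound: among the first 2n terms, the odd denominators contribute at
    most pi^2 / 8 and the even ones a quarter of the first n terms. *)
Lemma sum_inv2_le (R : realType) n :
  \sum_(k < n) (k.+1%:R : R) ^- 2 <= pi ^+ 2 / 6.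
Proof.
pose S := \sum_(k < n) (k.+1%:R : R) ^- 2.
have : S <= \sum_(k < n + n) (k.+1%:R : R) ^- 2.
  by rewrite big_split_ord/= lerDl sumr_ge0// => k _; rewrite invr_ge0 exprn_ge0.
have -> : \sum_(k < n + n) (k.+1%:R : R) ^- 2 =
    \sum_(k < n) ((2 * k + 1)%:R : R) ^- 2 + S / 4.
  rewrite /S mulr_suml -big_split/=; elim: {S} n => [|n IHn].
    by rewrite !big_ord0.
  rewrite addnS addSn !big_ord_recr/= IHn -addrA; congr (_ + (_ + _)).
    by rewrite addnn mul2n addn1.
  rewrite (_ : (n + n).+2 = n.+1 * 2)%N; last by lia.
  by rewrite natrM exprMn invfM; congr (_ * _^-1); rewrite -natrX.
have := sum_odd_inv2 R n; rewrite -/S; lra.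
Qed.

(** * Hoeffding's two-point inequality *)

(** The value at y of the affine function that agrees with y |-> exp (- th y)
    at y = -1 and y = 1. *)
Definition exp_chord {R : realType} (th y : R) : R :=
  ((1 - y) * expR th + (1 + y) * expR (- th)) / 2.

(** Hoeffding's lemma for two-point distributions.  Multiplied by exp th, the
    inequality says that G th >= 0 for the G below.  G vanishes at 0, and its
    derivative has the sign of k - k 0, where k is nondecreasing because its
    derivative is a square times an exponential. *)
Lemma exp_chord_le (R : realType) (th mu : R) : 0 <= th ->
  exp_chord th mu <= expR (th ^+ 2 / 2 - th * mu).
Proof.
rewrite /exp_chord => th0.
pose k (x : R) : R := (x - mu + 1) * expR (x ^+ 2 / 2 - x * mu - x).
have k0 x : 0 <= x -> 1 - mu <= k x.
  move=> x0; have -> : 1 - mu = k 0.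
    by rewrite /k !mul0r expr0n/= mul0r !subr0 expR0 mulr1 add0r addrC.
  apply: (@ger0_is_derive_ge _ k
     (fun x => (x - mu) ^+ 2 * expR (x ^+ 2 / 2 - x * mu - x))) => // [y|y y0].
    rewrite /k; apply: is_derive_eq.
    by rewrite /GRing.scale/=; field.
  by rewrite mulr_ge0 ?expR_ge0 ?sqr_ge0.
pose G (x : R) : R := expR (x ^+ 2 / 2 - x * mu + x)
   - ((1 - mu) * expR (2 * x) + (1 + mu)) / 2.
have G0 : 0 <= G th.
  have -> : 0 = G 0.
    by rewrite /G !mulr0 !mul0r expr0n/= mul0r subr0 addr0 expR0; field.
  apply: (@ger0_is_derive_ge _ G
     (fun x => expR (2 * x) * (k x - (1 - mu)))) => // [y|y y0].
    rewrite /G; apply: is_derive_eq.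
    rewrite /k /GRing.scale/=.
    have -> : y ^+ 2 / 2 - y * mu + y = 2 * y + (y ^+ 2 / 2 - y * mu - y) by ring.
    by rewrite expRD; field.
  by rewrite mulr_ge0 ?expR_ge0// subr_ge0 k0.
rewrite -(@ler_pM2r _ (expR th)) ?expR_gt0// -expRD.
move: G0; rewrite /G subr_ge0; apply: le_trans.
have -> : expR (2 * th) = expR th * expR th by rewrite -expRD; congr expR; ring.
have e : expR th != 0 by rewrite gt_eqF ?expR_gt0.
by rewrite expRN le_eqVlt; apply/orP; left; apply/eqP; field.
Qed.

Lemma expR_le_chord (R : realType) (th y : R) : -1 <= y <= 1 ->
  expR (- (th * y)) <= exp_chord th y.
Proof.
rewrite /exp_chord => y1.
have t1 : 0 <= (1 + y) / 2 <= 1 by lra.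
have := convex_expR (Itv01 (andP t1).1 (andP t1).2) (- th) th.
rewrite !convRE/= /unstable.onem.
rewrite (_ : _ + _ = - (th * y)); last by field.
move=> /le_trans; apply; lra.
Qed.

(** * Integrating against a weight measurable for a sub-sigma-algebra *)

Section sub_sigma_algebra.
Context {d : measure_display} {T : measurableType d}.
Implicit Types H K : set (set T).

Lemma sub_sigma_measurable H : H `<=` measurable -> <<s H >> `<=` measurable.
Proof.
by move=> HM; apply: smallest_sub => //; exact: sigma_algebra_measurable.
Qed.

Lemma sub_measurableW {H K d'} {Y : measurableType d'} {f : T -> Y} :
  H `<=` K -> sub_measurable H f -> sub_measurable K f.
Proof.
move=> HK mf _ B mB; have := mf measurableT B mB.
by apply: sub_smallest2r => //; exact: smallest_sigma_algebra.
Qed.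

Lemma sub_measurable_fun {H d'} {Y : measurableType d'} {f : T -> Y} :
  H `<=` measurable -> sub_measurable H f -> measurable_fun setT f.
Proof.
move=> HM mf _ B mB; apply: (sub_sigma_measurable HM).
exact: mf measurableT B mB.
Qed.

End sub_sigma_algebra.

Section pull_out.
Context {d : measure_display} {T : measurableType d} {R : realType}.
Variables (mu : {measure set T -> \bar R}) (H : set (set T)).
Hypotheses (sH : sigma_algebra setT H) (HM : H `<=` measurable).

Import HBNNSimple.

Let sHE A : <<s H >> A -> H A.
Proof. by rewrite sigma_algebra_id. Qed.

Let nnsfun_level (h : {nnsfun (g_sigma_algebraType H) >-> R}) y :
  H (h @^-1` [set y]).
Proof. by apply: sHE; exact: (measurable_sfunP h). Qed.

Let integral_nnsfun_mul (h : {nnsfun (g_sigma_algebraType H) >-> R})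
    (U : T -> R) : measurable_fun setT U -> (forall w, 0 <= U w) ->
  (\int[mu]_w (h w * U w)%:E =
   \sum_(y \in range h) y%:E * \int[mu]_(w in h @^-1` [set y]) (U w)%:E)%E.
Proof.
move=> mU U0.
transitivity (\int[mu]_w
    (\sum_(y \in range h) (y * ((\1_(h @^-1` [set y] : set T) : T -> R) w * U w))%:E))%E.
  apply: eq_integral => w _; rewrite fimfunE fsbig_finite//= mulr_suml -sumEFin.
  by rewrite fsbig_finite//=; apply: eq_bigr => y _; rewrite mulrA.
have ml y : measurable (h @^-1` [set y] : set T).
  by apply: HM; exact: nnsfun_level.
pose f y : T -> R := fun w => (\1_(h @^-1` [set y] : set T) : T -> R) w * U w.
have m1 y : measurable_fun setT (EFin \o f y : T -> \bar R).
  by apply/measurable_EFinP; apply: measurable_funM => //; exact: measurable_indic.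
rewrite ge0_integral_fsum//; last 2 first.
- move=> y; under eq_fun do rewrite EFinM; apply: measurable_funeM; exact: m1.
- move=> y w _; rewrite lee_fin.
  (* away from the range of h the indicator vanishes *)
  rewrite indicE; case: (boolP (w \in _)) => [|_]; last by rewrite mul0r mulr0.
  by rewrite inE/= => <-; rewrite mul1r mulr_ge0 ?U0 ?fun_ge0.
apply: eq_fsbigr => y; rewrite inE => -[x _ <-].
have hx0 : 0 <= h x by exact: fun_ge0.
under eq_integral do rewrite EFinM.
rewrite ge0_integralZl//; first last.
- by move=> w _; rewrite lee_fin mulr_ge0.
- exact: m1.
rewrite [in RHS]integral_mkcond; congr (_ * _)%E.
apply: eq_integral => w _; rewrite /patch indicE.
by case: (w \in _); rewrite ?mul1r// mul0r.
Qed.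

(** This replaces the rule E[V U | H] = V E[U | H].  The comparison of integrals
    over the sets of H extends to simple V by linearity, and to nonnegative V by
    monotone convergence; products with infinite integral are allowed. *)
Lemma le_integral_mul (V U1 U2 : T -> R) :
    sub_measurable H V -> (forall w, 0 <= V w) ->
    measurable_fun setT U1 -> (forall w, 0 <= U1 w) ->
    measurable_fun setT U2 -> (forall w, 0 <= U2 w) ->
    (forall A, H A ->
      (\int[mu]_(w in A) (U1 w)%:E <= \int[mu]_(w in A) (U2 w)%:E)%E) ->
  (\int[mu]_w (V w * U1 w)%:E <= \int[mu]_w (V w * U2 w)%:E)%E.
Proof.
move=> mV V0 mU1 U10 mU2 U20 U12.
have mV' : measurable_fun [set: g_sigma_algebraType H]
    (EFin \o V : g_sigma_algebraType H -> \bar R) by exact/measurable_EFinP.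
pose h := nnsfun_approx measurableT mV'.
have mh n : measurable_fun [set: T] (h n).
  by apply: (sub_measurable_fun HM); rewrite /sub_measurable; exact: measurable_funP.
have hV w : (h n w)%:E @[n --> \oo] --> (V w)%:E.
  apply: (@cvg_nnsfun_approx _ (g_sigma_algebraType H) R _ measurableT _ mV') => //.
  by move=> x _; rewrite /= lee_fin.
have lim (U : T -> R) : measurable_fun setT U -> (forall w, 0 <= U w) ->
    (\int[mu]_w (h n w * U w)%:E @[n --> \oo] --> \int[mu]_w (V w * U w)%:E)%E.
  move=> mU U0; rewrite (_ : (\int[mu]_w _)%E =
      (\int[mu]_w limn (fun n => (h n w * U w)%:E))%E); last first.
    apply: eq_integral => w _; apply/esym/cvg_lim => //.
    under eq_fun do rewrite EFinM; rewrite EFinM.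
    by apply: cvgeZr.
  apply: cvg_monotone_convergence => //.
  - by move=> n; apply/measurable_EFinP/measurable_funM.
  - by move=> n w _; rewrite lee_fin mulr_ge0 ?fun_ge0.
  - move=> w _ m n mn; rewrite lee_fin ler_wpM2r//.
    by have /lefP := nd_nnsfun_approx measurableT mV' mn; apply.
have L1 := lim _ mU1 U10; have L2 := lim _ mU2 U20.
rewrite -(cvg_lim _ L1)// -(cvg_lim _ L2)//; apply: lee_lim.
- exact: cvgP L1.
- exact: cvgP L2.
apply: nearW => n; rewrite !integral_nnsfun_mul//.
apply: lee_fsum => [|y _]; first exact: fimfunP.
have [y0|y0] := leP 0 y.
  by rewrite lee_wpmul2l ?lee_fin// U12//; exact: nnsfun_level.
(* the level set of a negative value is empty *)
rewrite (_ : _ @^-1` _ = set0) ?integral_set0 ?mule0//.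
apply/seteqP; split => // w /= hy; move: y0; rewrite -hy ltNge.
by rewrite fun_ge0.
Qed.
End pull_out.

(** * The Azuma-Hoeffding inequality *)

Section azuma_hoeffding.
Context {d : measure_display} {T : measurableType d} {R : realType}.
Variable P : probability T R.

Lemma integrable_itvN11 (Y : T -> R) :
  measurable_fun setT Y -> (forall w, -1 <= Y w <= 1) ->
  P.-integrable setT (EFin \o Y).
Proof.
move=> mY Y1; apply: measurable_bounded_integrable => //.
  by rewrite (le_lt_trans (probability_le1 P measurableT))// ltry.
exists 1; split; first exact: num_real.
by move=> x x1 w _ /=; rewrite (le_trans _ (ltW x1))// ler_norml; exact: Y1.
Qed.

Let exp_chordE (th y : R) : exp_chord th y =
  (expR th + expR (- th)) / 2 + ((expR (- th) - expR th) / 2) * y.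
Proof. by rewrite /exp_chord; field. Qed.

Let integrable_affine (a b : R) (Y : T -> R) : P.-integrable setT (EFin \o Y) ->
  P.-integrable setT (fun w => (a + b * Y w)%:E).
Proof.
move=> iY; have := integrableD measurableT
  (finite_measure_integrable_cst P a measurableT) (integrableZl measurableT b iY).
by apply: eq_integrable.
Qed.

Let integral_affine (a b : R) (Y : T -> R) A : measurable A ->
  P.-integrable setT (EFin \o Y) ->
  (\int[P]_(w in A) (a + b * Y w)%:E =
   \int[P]_(w in A) a%:E + b%:E * \int[P]_(w in A) (Y w)%:E)%E.
Proof.
move=> mA iY; have iYA := integrableS measurableT mA (@subsetT _ A) iY.
under eq_integral do rewrite EFinD EFinM.
rewrite integralD//; last 2 first.
- exact: finite_measure_integrable_cst.
- exact: integrableZl.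
by rewrite integralZl.
Qed.

(** E[exp (- th (Y - Z)) | H] <= exp (th^2 / 2), in integrated form.  The factor
    exp (th Z) is absorbed into the weight V, which leaves exp (- th Y); this is
    bounded by its chord, and the chord integrates over sets of H like the
    chord at Z. *)
Lemma condexp_hoeffding {H : set (set T)} (sH : sigma_algebra setT H)
    (HM : H `<=` measurable) (Y Z V : T -> R) (th : R) :
  measurable_fun setT Y -> (forall w, -1 <= Y w <= 1) ->
  is_condexp P H Y Z -> 0 <= th ->
  sub_measurable H V -> (forall w, 0 <= V w) ->
  (\int[P]_w (V w * expR (- (th * (Y w - Z w))))%:E
     <= (expR (th ^+ 2 / 2))%:E * \int[P]_w (V w)%:E)%E.
Proof.
move=> mY Y1 [mZ iZ EZ] th0 mV V0.
have iY := integrable_itvN11 mY Y1.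
pose V' w := V w * expR (th * Z w).
have mV' : sub_measurable H V'.
  apply: measurable_funM => //; apply: measurableT_comp => //.
  exact: measurable_funM.
have V'0 w : 0 <= V' w by rewrite mulr_ge0 ?expR_ge0.
have mZT := sub_measurable_fun HM mZ.
have mVT := sub_measurable_fun HM mV.
have mV'T := sub_measurable_fun HM mV'.
pose U1 w := exp_chord th (Y w).
pose U2 w := Num.max (exp_chord th (Z w)) 0.
have mchord (f : T -> R) : measurable_fun setT f ->
    measurable_fun setT (fun w => exp_chord th (f w)).
  move=> mf; under eq_fun do rewrite exp_chordE.
  by apply: measurable_funD => //; exact: measurable_funM.
have mU1 : measurable_fun setT U1 by exact: mchord.
have mU2 : measurable_fun setT U2.
  by apply: measurable_maxr => //; exact: mchord.
have U10 w : 0 <= U1 w.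
  by rewrite (le_trans _ (expR_le_chord th (Y1 w)))// expR_ge0.
have U20 w : 0 <= U2 w by rewrite le_max lexx orbT.
have ichord (f : T -> R) : P.-integrable setT (EFin \o f) ->
    P.-integrable setT (fun w => (exp_chord th (f w))%:E).
  move=> intf; under eq_fun do rewrite exp_chordE.
  exact: integrable_affine.
have U12 A : H A ->
    (\int[P]_(w in A) (U1 w)%:E <= \int[P]_(w in A) (U2 w)%:E)%E.
  move=> HA; have mA := HM _ HA.
  apply: (@le_trans _ _ (\int[P]_(w in A) (exp_chord th (Z w))%:E)%E).
    under eq_integral do rewrite /U1 exp_chordE.
    under [leRHS]eq_integral do rewrite exp_chordE.
    by rewrite !integral_affine// EZ.
  apply: le_integral => //.
  - exact: (integrableS measurableT mA (@subsetT _ A) (ichord _ iZ)).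
  - apply: (integrableS measurableT mA (@subsetT _ A)).
    apply: (@le_integrable _ _ _ _ _ _ _ (fun w => (exp_chord th (Z w))%:E)) => //.
    + exact/measurable_EFinP.
    + move=> w _; rewrite /U2 lee_fin /Num.max/=.
      by case: ifPn => // _; rewrite normr0.
    + exact: ichord.
  - by move=> w _; rewrite lee_fin /U2 le_max lexx.
apply: (@le_trans _ _ (\int[P]_w (V' w * U1 w)%:E)%E).
  apply: ge0_le_integral => //.
  - by move=> w _; rewrite lee_fin mulr_ge0 ?expR_ge0.
  - apply/measurable_EFinP/measurable_funM => //.
    apply: measurableT_comp => //; apply: measurableT_comp => //.
    by apply: measurable_funM => //; exact: measurable_funB.
  - by apply/measurable_EFinP/measurable_funM.
  - move=> w _; rewrite lee_fin /V' -mulrA ler_wpM2l//.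
    rewrite mulrBr opprB addrC expRD mulrC ler_wpM2l ?expR_ge0//.
    exact: expR_le_chord.
apply: (le_trans (le_integral_mul sH HM mV' V'0 mU1 U10 mU2 U20 U12)).
rewrite -ge0_integralZl//; last 2 first.
- exact/measurable_EFinP.
- by move=> w _; rewrite lee_fin.
apply: ge0_le_integral => //.
- by move=> w _; rewrite lee_fin mulr_ge0.
- by apply/measurable_EFinP/measurable_funM.
- by apply: measurable_funeM; exact/measurable_EFinP.
move=> w _; rewrite -EFinM lee_fin /V' mulrAC -mulrA mulrC ler_wpM2r//.
(* where Z w > 1 the chord at Z w may be negative, hence the truncation at 0 in
   U2; exp_chord_le applies to every real value of Z w *)
have U2le : U2 w <= expR (th ^+ 2 / 2 - th * Z w).
  by rewrite ge_max expR_ge0 exp_chord_le.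
rewrite (le_trans (ler_wpM2r (expR_ge0 _) U2le))// -expRD.
by rewrite subrK.
Qed.

Section martingale.
Variables (F : nat -> set (set T)) (hF : is_filtration F).
Variables (Y Z : nat -> T -> R).
Hypotheses (mY : forall t, (1 <= t)%N -> sub_measurable (F t) (Y t))
  (Y1 : forall t, (1 <= t)%N -> forall w, -1 <= Y t w <= 1)
  (EYZ : forall t, (1 <= t)%N -> is_condexp P (F t.-1) (Y t) (Z t)).

Let sF n : sigma_algebra setT (F n). Proof. by case: hF. Qed.
Let FM n : F n `<=` measurable. Proof. by case: hF => _ + _; apply. Qed.
Let Fmono m n : (m <= n)%N -> F m `<=` F n.
Proof. by case: hF => _ _; apply. Qed.

Let mZ t : (1 <= t)%N -> sub_measurable (F t.-1) (Z t).
Proof. by move=> t1; have [] := EYZ t1. Qed.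

Let Q (th : R) n w :=
  \prod_(1 <= t < n.+1) expR (- (th * (Y t w - Z t w))).

Let mQ th n : sub_measurable (F n) (Q th n).
Proof.
apply: measurable_prod => t; rewrite mem_index_iota ltnS => /andP[t1 tn].
apply: measurableT_comp => //; apply: measurableT_comp => //.
apply: measurable_funM => //; apply: measurable_funB.
- exact: (sub_measurableW (Fmono tn) (mY t1)).
- by apply: (sub_measurableW _ (mZ t1)); apply: Fmono; rewrite (leq_trans (leq_pred t)).
Qed.

Let Q0 th n w : 0 <= Q th n w.
Proof. by apply: prodr_ge0 => t _; exact: expR_ge0. Qed.

Let integral_Q th n : 0 <= th ->
  (\int[P]_w (Q th n w)%:E <= (expR (n%:R * (th ^+ 2 / 2)))%:E)%E.
Proof.
move=> th0; elim: n => [|n IHn].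
  under eq_integral do rewrite /Q big_geq//.
  by rewrite integral_cst// mul1e mul0r expR0 probability_le1.
under eq_integral do rewrite /Q big_nat_recr//=.
have mYn := sub_measurable_fun (@FM _) (mY (ltn0Sn n)).
have := condexp_hoeffding (sF n) (@FM n) mYn (Y1 (ltn0Sn n)) (EYZ (ltn0Sn n))
  th0 (@mQ th n) (@Q0 th n).
move=> /le_trans; apply; rewrite -[n.+1%:R]natr1 mulrDl mul1r expRD [expR _ * _]mulrC EFinM.
by rewrite lee_wpmul2l// lee_fin expR_ge0.
Qed.

Let mdev n : measurable_fun setT
  (fun w => \sum_(1 <= t < n.+1) Y t w - \sum_(1 <= t < n.+1) Z t w).
Proof.
apply: measurable_funB; under eq_fun do rewrite big_add1;
  apply: measurable_sum => t.
- exact: (sub_measurable_fun (@FM _) (mY (ltn0Sn t))).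
- exact: (sub_measurable_fun (@FM _) (mZ (ltn0Sn t))).
Qed.

(** Chernoff's method: Markov's inequality for the exponential of the martingale,
    with the optimal th = x / n. *)
Lemma azuma_hoeffding n (x : R) : (1 <= n)%N -> 0 <= x ->
  (P [set w | (\sum_(1 <= t < n.+1) Y t w - \sum_(1 <= t < n.+1) Z t w < - x)%R]
     <= (expR (- (x ^+ 2 / (2 * n%:R))))%:E)%E.
Proof.
move=> n1 x0; set A := [set w | _].
have n0 : 0 < n%:R :> R by rewrite ltr0n.
have mA : measurable A.
  have := mdev n measurableT (measurable_itv `]-oo, (- x)[).
  by rewrite setTI /A; congr (measurable _); apply/seteqP; split => w /=;
    rewrite in_itv.
pose th := x / n%:R.
have th0 : 0 <= th by rewrite divr_ge0// ltW.
have QA w : A w -> expR (th * x) <= Q th n w.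
  move=> Aw; rewrite /Q -expR_sum ler_expR sumrN -mulr_sumr sumrB -mulrN.
  by rewrite ler_wpM2l// lerNr ltW.
have : ((expR (th * x))%:E * P A <= (expR (n%:R * (th ^+ 2 / 2)))%:E)%E.
  apply: le_trans (integral_Q n th0).
  have mQn : measurable_fun setT (EFin \o Q th n).
    by apply/measurable_EFinP; exact: (sub_measurable_fun (@FM n) (@mQ th n)).
  have Qn0 w : (0 <= (Q th n w)%:E)%E by rewrite lee_fin.
  rewrite -integral_cst//.
  apply: (@le_trans _ _ (\int[P]_(w in A) (Q th n w)%:E)%E).
    apply: ge0_le_integral => //.
    - by move=> w _; rewrite lee_fin expR_ge0.
    - exact: measurable_funTS.
  by apply: ge0_subset_integral => //; exact: measurableT.
rewrite -lee_pdivlMl ?expR_gt0// => /le_trans; apply.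
rewrite -EFinM lee_fin -expRN -expRD ler_expR /th.
by rewrite le_eqVlt; apply/orP; left; apply/eqP; field; rewrite gt_eqF.
Qed.

End martingale.
End azuma_hoeffding.

(** * Series of probabilities and sequences of events *)

Lemma lee_nneseries_nat (R : realType) N (u v : nat -> \bar R) :
  (forall n, (N <= n)%N -> (0 <= u n)%E) ->
  (forall n, (N <= n)%N -> (u n <= v n)%E) ->
  (\sum_(N <= n <oo) u n <= \sum_(N <= n <oo) v n)%E.
Proof.
move=> u0 uv; apply: lee_lim.
- by apply: is_cvg_nneseries => n Nn _; exact: u0.
- apply: is_cvg_nneseries => n Nn _; exact: le_trans (u0 _ Nn) (uv _ Nn).
- apply: nearW => n; rewrite big_nat [leRHS]big_nat.
  by apply: lee_sum => i /andP[+ _]; exact: uv.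
Qed.

Lemma nneseries_inv2_le (R : realType) :
  (\sum_(1 <= n <oo) ((n%:R : R) ^- 2)%:E <= (pi ^+ 2 / 6)%:E)%E.
Proof.
apply: lime_le.
  by apply: is_cvg_nneseries => n _ _; rewrite lee_fin invr_ge0 exprn_ge0.
apply: nearW => -[|n].
  by rewrite big_geq// lee_fin divr_ge0// exprn_ge0// ltW// pi_gt0.
by rewrite sumEFin lee_fin big_add1/= big_mkord sum_inv2_le.
Qed.

Section event_sequences.
Context {d : measure_display} {T : measurableType d} {R : realType}.
Variables (P : probability T R) (A : nat -> set T).
Hypothesis mA : forall n, (1 <= n)%N -> measurable (A n).

(** Padding with empty sets turns series starting at N into series starting
    at 0. *)
Let B N n : set T := [set w | (N <= n)%N /\ A n w].

Let BE N n : (N <= n)%N -> B N n = A n.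
Proof. by move=> Nn; apply/seteqP; split => w /=; [case|]. Qed.

Let B0 N n : (n < N)%N -> B N n = set0.
Proof. by rewrite ltnNge => /negP Nn; apply/seteqP; split => w //= -[]. Qed.

Let mB N n : (1 <= N)%N -> measurable (B N n).
Proof.
move=> N1; have [Nn|nN] := leqP N n; last by rewrite B0.
by rewrite BE//; apply: mA; exact: leq_trans Nn.
Qed.

Let nneseries_B N : (1 <= N)%N ->
  (\sum_(n <oo) P (B N n) <= \sum_(1 <= n <oo) P (A n))%E.
Proof.
move=> N1; rewrite nneseries_recl// B0// measure0 add0e.
apply: lee_nneseries_nat => // n n1.
have [Nn|nN] := leqP N n; first by rewrite BE.
by rewrite B0// measure0.
Qed.

Lemma borel_cantelli : (\sum_(1 <= n <oo) P (A n) < +oo)%E ->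
  {ae P, forall w, \forall n \near \oo, ~ A n w}.
Proof.
move=> fin; exists (lim_sup_set (B 1)); split.
- apply: bigcap_measurable => // n _; apply: bigcup_measurable => k _.
  exact: mB.
- apply: lim_sup_set_cvg0 => [n|]; first exact: mB.
  exact: le_lt_trans (nneseries_B _) fin.
- move=> w /= nw N _.
  apply: contrapT => nN; apply: nw; exists N.+1 => // n /= Nn Anw.
  by apply: nN; exists n; [exact: ltnW|split => //; exact: leq_trans Nn].
Qed.

(** tau cannot exceed the first n >= N at which A n fails, and up to that index
    every event from N on occurs; so tau - N is at most the number of events
    that occur, whose expectation is the series. *)
Lemma integral_first_exit_le (tau : T -> \bar R) N : (1 <= N)%N ->
  measurable_fun setT tau -> (forall w, (0 <= tau w)%E) ->
  (forall n w, (N <= n)%N -> ~ A n w -> (tau w <= n%:R%:E)%E) ->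
  (\int[P]_w tau w <= \sum_(1 <= n <oo) P (A n) + N%:R%:E)%E.
Proof.
move=> N1 mtau tau0 tauA.
pose C w : \bar R := (\sum_(n <oo) (\1_(B N n) w)%:E)%E.
have C0 w : (0 <= C w)%E by apply: nneseries_ge0 => n _ _; rewrite lee_fin.
have m1 n : measurable_fun setT (EFin \o \1_(B N n) : T -> \bar R).
  by apply/measurable_EFinP; apply: measurable_indic; exact: mB.
have mC : measurable_fun setT C.
  apply: (@ge0_emeasurable_sum _ _ _ _ (fun n w => (\1_(B N n) w)%:E) xpredT) => // n _.
  exact: m1.
(* as long as the events N, ..., N + k - 1 occur, they contribute k *)
have Ck w k : (forall n, (N <= n < N + k)%N -> A n w) -> (k%:R%:E <= C w)%E.
  move=> Aw; apply: le_trans (nneseries_lim_ge (N + k) _); last first.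
    by move=> n _ _; rewrite lee_fin.
  rewrite (big_cat_nat (n := N))//=; last exact: leq_addr.
  rewrite -[leLHS]add0e leeD//; first by apply: sume_ge0 => n _; rewrite lee_fin.
  rewrite (eq_big_nat _ _ (F2 := fun=> 1%E)); last first.
    by move=> n Nn; rewrite indicE mem_set//; split; [case/andP: Nn|exact: Aw].
  by rewrite sumEFin sumr_const_nat addKn.
have tauC w : (tau w <= N%:R%:E + C w)%E.
  have [allA|] := pselect (forall n, (N <= n)%N -> A n w).
    rewrite (_ : C w = +oo%E) ?addey ?leey//.
    apply/eqyP => r r0; apply: (@le_trans _ _ (Num.truncn r).+1%:R%:E).
      by rewrite lee_fin ltW// truncnS_gt.
    by apply: Ck => n /andP[+ _]; exact: allA.
  move=> /existsNP[n0 /not_implyP[Nn0 An0]].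
  have ex : exists n, (N <= n)%N && `[< ~ A n w >].
    by exists n0; rewrite Nn0; exact/asboolP.
  case: (ex_minnP ex) => k /andP[Nk /asboolP Akw] kmin.
  apply: le_trans (tauA _ _ Nk Akw) _.
  rewrite -(subnKC Nk) natrD EFinD leeD2l// Ck// => n /andP[Nn nk].
  apply: contrapT => nA; move: nk; rewrite subnKC// ltnNge => /negP; apply.
  by apply: kmin; rewrite Nn; exact/asboolP.
apply: (@le_trans _ _ (\int[P]_w (N%:R%:E + C w))%E).
  by apply: ge0_le_integral => //; exact: emeasurable_funD.
rewrite ge0_integralD//.
rewrite integral_cst// [X in (_ * X + _ <= _)%E]probability_setT mule1 addeC leeD2r//.
rewrite integral_nneseries//.
apply: le_trans (nneseries_B N1); apply: lee_nneseries_nat => n _.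
  by apply: integral_ge0 => w _; rewrite lee_fin.
by rewrite integral_indic ?setIT//; exact: mB.
Qed.

End event_sequences.

Lemma measurable_set_ltr {d : measure_display} {T : measurableType d}
    (R : realType) (f g : T -> R) :
  measurable_fun setT f -> measurable_fun setT g ->
  measurable [set w | f w < g w].
Proof.
move=> mf mg; rewrite (_ : [set w | _] = ~` [set w | g w <= f w]).
  by apply: measurableC; rewrite -[X in measurable X]setTI;
    exact: measurable_fun_le.
by apply/seteqP; split => w /=; rewrite ltNge => /negP.
Qed.

Lemma limn_einf_ge (R : realType) (u : (\bar R)^nat) (x : \bar R) :
  (\forall n \near \oo, (x <= u n)%E) -> (x <= limn_einf u)%E.
Proof.
move=> [N _ Nu]; rewrite limn_einf_lim; apply: lime_ge; first exact: is_cvg_einfs.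
exists N => // n /= Nn; apply: le_ereal_inf_tmp => _ [k /= nk <-].
by apply: Nu; exact: leq_trans nk.
Qed.

(** * Wealth and regret *)

Section wealth.
Context {R : realType} {d d' : measure_display}.
Context {Omega : measurableType d} {XX : measurableType d'}.
Variables (X : nat -> Omega -> XX) (g : nat -> Omega -> XX -> R).

Lemma ln_LH lam n w :
  ln (LH X g lam n w) =
  lam * (\sum_(1 <= t < n.+1) g t w (X t w)) - n%:R * (lam ^+ 2 / 2).
Proof.
rewrite /LH -expR_sum expRK sumrB -mulr_sumr sumr_const_nat.
by rewrite subn1/= mulr_natl.
Qed.

Lemma ln_WH lambda n w :
  ln (WH X g lambda n w) =
  \sum_(1 <= t < n.+1) (lambda t w * g t w (X t w) - lambda t w ^+ 2 / 2).
Proof. by rewrite /WH -expR_sum expRK. Qed.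

Lemma WH_gt0 lambda n w : 0 < WH X g lambda n w.
Proof. by rewrite /WH -expR_sum expR_gt0. Qed.

Lemma sub_measurable_prediction F G t : is_filtration F -> adapted F X ->
  prediction_strategy F G g -> (1 <= t)%N ->
  sub_measurable (F t) (fun w => g t w (X t w)).
Proof.
move=> [_ _ Fmono] hX hg t1; have [_ mg] := hg t t1.
have mid : sub_measurable (F t) (id : Omega -> g_sigma_algebraType (F t.-1)).
  apply: (@sub_measurableW _ _ (F t.-1)); first exact/Fmono/leq_pred.
  exact: measurable_id.
exact: (measurableT_comp mg (measurable_fun_pair mid (hX t))).
Qed.

(** The hitting time is the infimum over n of the functions worth n on the event
    1 / alpha <= W_n and +oo elsewhere. *)
Lemma measurable_tauH lambda (alpha : R) :
  (forall n, measurable_fun setT (WH X g lambda n)) ->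
  measurable_fun setT (tauH X g lambda alpha).
Proof.
move=> mWH.
pose f n w : \bar R :=
  if 1 / alpha <= WH X g lambda n w then n%:R%:E else +oo%E.
rewrite (_ : tauH X g lambda alpha = (fun w => einfs (f ^~ w) 0)).
  apply: measurable_fun_einfs => n; apply: measurable_fun_ifT => //.
  exact: measurable_fun_ler.
apply/funext => w; apply/eqP; rewrite eq_le; apply/andP; split.
  apply: le_ereal_inf_tmp => _ [n _ <-]; rewrite /f; case: ifPn => // Wn.
    by apply: ereal_inf_lbound; exists n.
  by rewrite leey.
apply: le_ereal_inf_tmp => _ [n /= Wn <-].
by apply: ereal_inf_lbound; exists n => //; rewrite /f Wn.
Qed.

End wealth.

(** The vertex of the parabola is x / n, or x_+ / n under the constraint
    lam >= 0; c x is x or x_+ accordingly.  The exact value of the supremum makes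
    the regret a measurable function. *)
Lemma sup_log_likelihood (R : realType) (Lambda : set R) :
  Lambda = setT \/ Lambda = [set l | 0 <= l] ->
  exists c : R -> R, [/\ measurable_fun setT c,
    forall x, Num.max x 0 ^+ 2 <= c x ^+ 2 &
    forall n x, (1 <= n)%N ->
      ereal_sup [set (lam * x - n%:R * (lam ^+ 2 / 2))%:E | lam in Lambda] =
      (c x ^+ 2 / (2 * n%:R))%:E].
Proof.
move=> hL.
suff [c [mc c_ge cc cL cle]] : exists c : R -> R, [/\ measurable_fun setT c,
    forall x, Num.max x 0 ^+ 2 <= c x ^+ 2,
    forall x, c x * x = c x ^+ 2,
    forall n x, Lambda (c x / n%:R) &
    forall lam x, Lambda lam -> lam * x <= lam * c x].
  exists c; split => // n x n1.
  have n0 : 0 < n%:R :> R by rewrite ltr0n.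
  apply/eqP; rewrite eq_le; apply/andP; split.
    apply: ge_ereal_sup => _ [lam Llam <-]; rewrite lee_fin.
    rewrite (le_trans (lerD (cle _ x Llam) (lexx _)))//.
    rewrite ler_pdivlMr ?mulr_gt0// -subr_ge0.
    by rewrite (_ : _ - _ = (c x - n%:R * lam) ^+ 2) ?sqr_ge0//; field.
  apply: ereal_sup_ubound; exists (c x / n%:R); first exact: cL.
  congr EFin.
  by rewrite mulrAC cc; field; rewrite gt_eqF.
case: hL => ->.
  exists id; split => // x.
  by rewrite maxElt; case: ifPn => // _; rewrite expr0n sqr_ge0.
exists (fun x => Num.max x 0); split => [|//|x|n x|lam x /= lam0].
- exact: measurable_maxr.
- by rewrite maxElt; case: ifPn; rewrite ?mul0r ?expr0n.
- by rewrite /= divr_ge0// le_max lexx orbT.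
- by rewrite ler_wpM2l// le_max lexx.
Qed.

(** The pathwise core: S is the realized gain, C its compensator, l the
    log-wealth, and the hypotheses say that none of the four bad events
    occurs. *)
Lemma log_wealth_ge (R : realType) (n : nat) (S C l s r m x : R) :
  (1 <= n)%N ->
  Num.max S 0 ^+ 2 / (2 * n%:R) - l <= r ->
  n%:R * m - s <= C -> - x <= S - C ->
  1 / (2 * n%:R) * Num.max (n%:R * m - s - x) 0 ^+ 2 - r <= l.
Proof.
move=> n1 hr hC hx; have n0 : 0 < n%:R :> R by rewrite ltr0n.
have aS : n%:R * m - s - x <= S by lra.
have : Num.max (n%:R * m - s - x) 0 ^+ 2 <= Num.max S 0 ^+ 2.
  rewrite lerXn2r ?nnegrE ?[0 <= Num.max _ _]le_max ?lexx ?orbT//.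
  by rewrite ge_max !le_max aS lexx orbT.
rewrite -(@ler_pM2r _ (2 * n%:R)^-1) ?invr_gt0 ?mulr_gt0// => h.
rewrite mul1r mulrC; lra.
Qed.

(** The deviation 2 sqrt (n log n) is tuned so that its Azuma-Hoeffding bound is
    the general term of a convergent series. *)
Lemma expR_deviation (R : realType) (n : nat) : (1 <= n)%N ->
  expR (- ((2 * Num.sqrt (n%:R * ln n%:R)) ^+ 2 / (2 * n%:R))) =
  (n%:R : R) ^- 2.
Proof.
move=> n1; have n0 : 0 < n%:R :> R by rewrite ltr0n.
have ln0 : 0 <= ln n%:R :> R by rewrite ln_ge0// ler1n.
rewrite exprMn sqr_sqrtr; last by rewrite mulr_ge0// ltW.
rewrite (_ : _ / _ = ln n%:R + ln n%:R); last by field; rewrite gt_eqF.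
by rewrite expRN expRD lnK ?posrE.
Qed.

(** * Growth of the wealth and expected hitting time *)

Unset Implicit Arguments.
Set Strict Implicit.
Set Printing Implicit Defensive.

Theorem theorem3p5 (R : realType) (d d' : measure_display)
  (Omega : measurableType d) (XX : measurableType d')
  (P : probability Omega R) (F : nat -> set (set Omega))
  (hF : is_filtration F)
  (E : nat -> (Omega -> R) -> Omega -> R) (hE : is_condexp_family P F E)
  (X : nat -> Omega -> XX) (hX : adapted F X)
  (G : set (XX -> R))
  (hG : forall f, G f -> measurable_fun setT f /\ forall x, -1 <= f x <= 1)
  (Lambda : set R) (hLambda : Lambda = setT \/ Lambda = [set l | 0 <= l])
  (lambda : nat -> Omega -> R) (hlambda : betting_strategy F Lambda lambda)
  (g : nat -> Omega -> XX -> R) (hg : prediction_strategy F G g)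
  (s r m : nat -> R)
  (hs : forall n, (1 <= n)%N -> 0 <= s n)
  (hr : forall n, (1 <= n)%N -> 0 <= r n)
  (hm : forall n, (1 <= n)%N -> 0 <= m n)
  (* the events involving a supremum over G, which may be uncountable, are
     assumed to be measurable, so that their probabilities make sense *)
  (meas_s : forall n, (1 <= n)%N ->
    measurable [set w | ((s n)%:E < stochastic_regret E X g G n w)%E])
  (meas_m : forall n, (1 <= n)%N ->
    measurable [set w |
      (ereal_sup [set (1 / n%:R * condexp_sum E X f n w)%:E | f in G]
       < (m n)%:E)%E])
  (varsigma rho varrho1 : \bar R)
  (varsigmaE : varsigma = (\sum_(1 <= n <oo)
    P [set w | (s n)%:E < stochastic_regret E X g G n w])%E)
  (varsigma_fin : (varsigma < +oo)%E)
  (rhoE : rho = (\sum_(1 <= n <oo)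
    P [set w | (r n)%:E < regret X g Lambda lambda n w])%E)
  (rho_fin : (rho < +oo)%E)
  (varrho1E : varrho1 = (\sum_(1 <= n <oo)
    P [set w |
      ereal_sup [set (1 / n%:R * condexp_sum E X f n w)%:E | f in G]
      < (m n)%:E])%E)
  (varrho1_fin : (varrho1 < +oo)%E)
  (u : nat -> R)
  (uE : forall n, (1 <= n)%N ->
    u n = 1 / (2 * n%:R)
          * (Num.max (n%:R * m n - s n - 2 * Num.sqrt (n%:R * ln n%:R)) 0) ^+ 2
          - r n) :
  [/\ (\sum_(1 <= n <oo) P [set w | (ln (WH X g lambda n w) < u n)%R]
        <= rho + varsigma + varrho1 + (pi ^+ 2 / 6)%:E)%E,
      (rho + varsigma + varrho1 + (pi ^+ 2 / 6)%:E < +oo)%E,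
      (* the ratio is only meaningful as a lower bound when u n is
         eventually positive *)
      (\forall n \near \oo, 0 < u n) ->
        {ae P, forall w,
          (1 <= limn_einf (fun n => (ln (WH X g lambda n w) / u n)%:E))%E} &
      forall alpha : R, 0 < alpha < 1 ->
        (\int[P]_w tauH X g lambda alpha w
          <= rho + varrho1 + varsigma + (pi ^+ 2 / 6)%:E
             + aleph u (ln (1 / alpha)))%E ].
Proof.
have [sF FM Fmono] := hF.
pose Y t w := g t w (X t w).
pose Z t := E t.-1 (Y t).
pose S n w := \sum_(1 <= t < n.+1) Y t w.
pose C n w := \sum_(1 <= t < n.+1) Z t w.
pose lnW n w := ln (WH X g lambda n w).
have mY t : (1 <= t)%N -> sub_measurable (F t) (Y t).
  exact: (sub_measurable_prediction hF hX hg).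
have mYT t : (1 <= t)%N -> measurable_fun setT (Y t).
  by move=> t1; exact: (sub_measurable_fun (FM t) (mY t t1)).
have Y1 t : (1 <= t)%N -> forall w, -1 <= Y t w <= 1.
  by move=> t1 w; have [Ggt _] := hg t t1; exact: (hG _ (Ggt w)).2.
have EYZ t : (1 <= t)%N -> is_condexp P (F t.-1) (Y t) (Z t).
  by move=> t1; apply: hE; apply: integrable_itvN11; [exact: mYT|exact: Y1].
have mS n : measurable_fun setT (S n).
  rewrite /S; under eq_fun do rewrite big_add1.
  by apply: measurable_sum => t; exact: mYT.
have mC n : measurable_fun setT (C n).
  rewrite /C; under eq_fun do rewrite big_add1.
  apply: measurable_sum => t; have [mZ _ _] := EYZ _ (ltn0Sn t).
  exact: (sub_measurable_fun (FM _) mZ).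
have mlam t : (1 <= t)%N -> measurable_fun setT (lambda t).
  by move=> t1; exact: (sub_measurable_fun (FM _) (hlambda.1 t t1)).
have mlnW n : measurable_fun setT (lnW n).
  rewrite /lnW; under eq_fun do rewrite ln_WH big_add1.
  apply: measurable_sum => t; have mt := mlam _ (ltn0Sn t).
  apply: measurable_funB; apply: measurable_funM => //; first exact: mYT.
  exact: measurable_funX.
have mWH n : measurable_fun setT (WH X g lambda n).
  rewrite (_ : WH X g lambda n = expR \o lnW n); last first.
    by apply/funext => w /=; rewrite lnK ?posrE// WH_gt0.
  exact: measurableT_comp.
have [c [mc c_ge cE]] := sup_log_likelihood hLambda.
have regretE n w : (1 <= n)%N -> regret X g Lambda lambda n w =
    (c (S n w) ^+ 2 / (2 * n%:R) - lnW n w)%:E.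
  move=> n1; rewrite /regret EFinB -(cE _ _ n1); congr (ereal_sup _ - _)%E.
  by apply: eq_imagel => lam _; rewrite ln_LH.
have mregret n : (1 <= n)%N ->
    measurable [set w | ((r n)%:E < regret X g Lambda lambda n w)%E].
  move=> n1; under eq_set do rewrite regretE// lte_fin.
  apply: measurable_set_ltr => //; apply: measurable_funB => //.
  apply: measurable_funM => //; apply: measurable_funX.
  exact: (measurableT_comp mc (mS n)).
pose A n := [set w | lnW n w < u n].
have mA n : (1 <= n)%N -> measurable (A n).
  by move=> _; exact: measurable_set_ltr.
pose x n : R := 2 * Num.sqrt (n%:R * ln n%:R).
pose D n := [set w | S n w - C n w < - x n].
have mD n : measurable (D n).
  by apply: measurable_set_ltr => //; exact: measurable_funB.
pose B1 n := [set w | ((r n)%:E < regret X g Lambda lambda n w)%E].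
pose B2 n := [set w | ((s n)%:E < stochastic_regret E X g G n w)%E].
pose B3 n := [set w |
  (ereal_sup [set (1 / n%:R * condexp_sum E X f n w)%:E | f in G]
     < (m n)%:E)%E].
(* four bad events: one for each of the three hypotheses, and the martingale
   deviation *)
have Asub n : (1 <= n)%N -> A n `<=` B1 n `|` B2 n `|` B3 n `|` D n.
  move=> n1 w Aw; apply: contrapT => /not_orP[/not_orP[/not_orP[b1 b2] b3] b4].
  have n0 : 0 < n%:R :> R by rewrite ltr0n.
  move: Aw; rewrite /A /= ltNge => /negP; apply; rewrite uE//.
  apply: (@log_wealth_ge _ n (S n w) (C n w)) => //.
  - move/negP : b1; rewrite regretE// -leNgt lee_fin; apply: le_trans.
    by rewrite lerD2r// ler_wpM2r// invr_ge0 mulr_ge0// ltW.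
  - move/negP : b2; rewrite -leNgt leeBlDr// => b2.
    move/negP : b3; rewrite -leNgt => b3.
    have : ((m n)%:E <= ((s n + C n w) / n%:R)%:E)%E.
      apply: (le_trans b3); apply: ge_ereal_sup => _ [f Gf <-].
      rewrite lee_fin mul1r mulrC ler_wpM2r ?invr_ge0 ?(ltW n0)//.
      rewrite -lee_fin EFinD; apply: le_trans b2.
      by apply: ereal_sup_ubound; exists f.
    by rewrite lee_fin ler_pdivlMr// mulrC lerBlDl.
  - by move/negP : b4; rewrite -leNgt.
have PA n : (1 <= n)%N ->
    (P (A n) <= P (B1 n) + P (B2 n) + P (B3 n) + ((n%:R : R) ^- 2)%:E)%E.
  move=> n1.
  have mB1 : measurable (B1 n) by exact: mregret.
  have mB2 : measurable (B2 n) by exact: meas_s.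
  have mB3 : measurable (B3 n) by exact: meas_m.
  have mB12 := measurableU _ _ mB1 mB2.
  have mB123 := measurableU _ _ mB12 mB3.
  apply: (@le_trans _ _ (P (B1 n `|` B2 n `|` B3 n `|` D n))).
    apply: le_measure; rewrite ?inE; [exact: mA|exact: measurableU|exact: Asub].
  apply: (le_trans (measureU2 _ mB123 (mD n))); apply: leeD.
    apply: (le_trans (measureU2 _ mB12 mB3)); apply: leeD => //.
    exact: measureU2.
  rewrite -expR_deviation//; apply: (azuma_hoeffding hF mY Y1 EYZ n1).
  by rewrite mulr_ge0// sqrtr_ge0.
have sumA : (\sum_(1 <= n <oo) P (A n)
    <= rho + varsigma + varrho1 + (pi ^+ 2 / 6)%:E)%E.
  apply: (@le_trans _ _ (\sum_(1 <= n <oo)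
      (P (B1 n) + P (B2 n) + P (B3 n) + ((n%:R : R) ^- 2)%:E))%E).
    exact: lee_nneseries_nat.
  have i0 n : (0 <= ((n%:R : R) ^- 2)%:E)%E by rewrite lee_fin invr_ge0 exprn_ge0.
  rewrite nneseriesD; [|by move=> *; rewrite !adde_ge0|by move=> *; exact: i0].
  rewrite nneseriesD; [|by move=> *; rewrite adde_ge0|by move=> *; exact: measure_ge0].
  rewrite nneseriesD; [|by move=> *; exact: measure_ge0|by move=> *; exact: measure_ge0].
  by rewrite rhoE varsigmaE varrho1E leeD2l// nneseries_inv2_le.
have fin : (rho + varsigma + varrho1 + (pi ^+ 2 / 6)%:E < +oo)%E.
  by rewrite !lte_add_pinfty// ltry.
split => //.
- move=> [N _ uN].
  have [Q [mQ PQ subQ]] := borel_cantelli mA (le_lt_trans sumA fin).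
  exists Q; split => // w /= low; apply: contrapT => Qw; apply: low.
  have [M _ AM] : \forall n \near \oo, ~ A n w.
    by apply: contrapT => io; apply: Qw; exact: subQ.
  apply: limn_einf_ge; exists (maxn N M) => // n /=.
  rewrite geq_max => /andP[Nn Mn]; rewrite lee_fin ler_pdivlMr; last exact: uN.
  by rewrite mul1r leNgt; apply/negP; exact: AM.
- move=> alpha /andP[a0 a1].
  have totalC : (rho + varrho1 + varsigma + (pi ^+ 2 / 6)%:E)%E =
      (rho + varsigma + varrho1 + (pi ^+ 2 / 6)%:E)%E by rewrite (addeAC rho).
  rewrite totalC -leeBlDl; last first.
    rewrite ge0_fin_numE//; apply: le_trans sumA.
    by apply: nneseries_ge0 => n _ _; exact: measure_ge0.
  (* aleph is an infimum: it suffices to bound by every admissible N *)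
  apply: le_ereal_inf_tmp => _ [N [N1 uN] <-]; rewrite leeBlDl; last first.
    rewrite ge0_fin_numE//; apply: le_trans sumA.
    by apply: nneseries_ge0 => n _ _; exact: measure_ge0.
  apply: (@le_trans _ _ (\sum_(1 <= n <oo) P (A n) + N%:R%:E)%E); last first.
    by rewrite leeD2r.
  apply: integral_first_exit_le => //.
  - exact: measurable_tauH.
  - by move=> w; apply: le_ereal_inf_tmp => _ [n _ <-]; rewrite lee_fin.
  - move=> n w Nn /negP; rewrite -leNgt => un.
    apply: ereal_inf_lbound; exists n => //=.
    rewrite -ler_ln ?posrE ?divr_gt0// ?WH_gt0//; apply: le_trans un.
    rewrite -lee_fin; apply: (le_trans uN).
    by apply: ereal_inf_lbound; exists n.
Qed.
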